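(* Let $d\ge 1$ and $n\ge 1$ be integers, and let $W_d(x)=\pi^{-d}\prod_{i=1}^d (1-x_i^2)^{-1/2}$ on $[-1,1]^d$. Let $I^E_n, I^O_n$ be the one-dimensional functionals defined as follows: if $n=2m$, $$I^E_n f := \frac{1}{n}\Big(\tfrac12 f(-1)+\sum_{j=1}^{m-1} f\big(\cos\tfrac{2j\pi}{n}\big)+\tfrac12 f(1)\Big),\qquad I^O_n f := \frac{1}{n}\sum_{j=1}^{m} f\big(\cos\tfrac{(2j-1)\pi}{n}\big);$$ if $n=2m-1$, $$I^E_n f := \frac{1}{n}\Big(\sum_{j=1}^{m-1} f\big(\cos\tfrac{2j\pi}{n}\big)+\tfrac12 f(1)\Big),\qquad I^O_n f := \frac{1}{n}\Big(\tfrac12 f(-1)+\sum_{j=1}^{m-1} f\big(\cos\tfrac{(2j-1)\pi}{n}\big)\Big).$$ For $\sigma=(\sigma_1,\ldots,\sigma_d)\in\{E,O\}^d$, let $\tilde\sigma$ be obtained by swapping $E\leftrightarrow O$ in each coordinate, and for $f:[-1,1]^d\to\mathbb{R}$ define $$I^{\sigma}_{n,d} f := I^{\sigma_1}_n\cdots I^{\sigma_d}_n f + I^{\tilde\sigma_1}_n\cdots I^{\tilde\sigma_d}_n f,$$ where $I^{\sigma_1}_n\cdots I^{\sigma_d}_n f$ denotes the $d$-fold sum in which $I^{\sigma_k}_n$ is applied to the $k$-th variable of $f$. Then for each $\sigma\in\{E,O\}^d$ the cubature formula $$\int_{[-1,1]^d} f(x)\,W_d(x)\,dx = 2^{d-1}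 I^{\sigma}_{n,d} f$$ holds for every polynomial $f$ in $d$ variables of total degree at most $2n-1$, and its number of nodes $N$ satisfies $N = 2\left(\lfloor n/2\rfloor\right)^d\,(1+O(n^{-1}))$ as $n\to\infty$.
   Context: The weight $W_d$ is the product Chebyshev weight, normalized so that $\int_{[-1,1]^d}W_d(x)\,dx=1$. The nodes of the formula are the points of the two product grids $G_{\sigma_1}\times\cdots\times G_{\sigma_d}$ and $G_{\tilde\sigma_1}\times\cdots\times G_{\tilde\sigma_d}$, where $G_E$ (resp. $G_O$) is the set of points $\cos\frac{j\pi}{n}$, $0\le j\le n$, at which $I^E_n$ (resp. $I^O_n$) evaluates $f$ (even $j$, resp. odd $j$); $N$ is the total number of these nodes. *)

(* Defs.v *)
From HB Require Import structures.
From mathcomp Require Import all_boot all_order all_algebra.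
(* mpoly must be imported before mathcomp-analysis (notation levels clash
   otherwise). *)
From mathcomp Require Import mpoly.
From mathcomp Require Import all_classical all_reals all_analysis.
Set Implicit Arguments. Unset Strict Implicit. Unset Printing Implicit Defensive.
Import Order.TTheory GRing.Theory Num.Theory.
Local Open Scope ring_scope.

Inductive EO := E | O.
Definition swapEO (s : EO) : EO := match s with E => O | O => E end.

Section Cubature.
Variable R : realType.

Definition cheb_weight (d : nat) (x : d.-tuple R) : R :=
  pi ^- d * \prod_(i < d) (Num.sqrt (1 - (tnth x i) ^+ 2))^-1.

Fixpoint cube_integral (d : nat) : (d.-tuple R -> R) -> \bar R :=
  match d with
  | 0 => fun g => (g [tuple])%:E
  | d'.+1 => fun g =>
      integral (@lebesgue_measure R) `[(-1)%R, 1%R]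
        (fun x : R => cube_integral (fun t : d'.-tuple R => g (@cons_tuple _ _ x t)))
  end.

Definition IE (n : nat) (h : R -> R) : R :=
  if ~~ odd n then
    let m := n./2 in
    n%:R^-1 * (h (-1) / 2 + \sum_(1 <= j < m) h (cos ((2 * j)%:R * pi / n%:R))
               + h 1 / 2)
  else
    let m := n.+1./2 in
    n%:R^-1 * (\sum_(1 <= j < m) h (cos ((2 * j)%:R * pi / n%:R)) + h 1 / 2).

Definition IO (n : nat) (h : R -> R) : R :=
  if ~~ odd n then
    let m := n./2 in
    n%:R^-1 * \sum_(1 <= j < m.+1) h (cos ((2 * j - 1)%:R * pi / n%:R))
  else
    let m := n.+1./2 in
    n%:R^-1 * (h (-1) / 2
               + \sum_(1 <= j < m) h (cos ((2 * j - 1)%:R * pi / n%:R))).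

Definition I1 (s : EO) (n : nat) : (R -> R) -> R :=
  match s with E => IE n | O => IO n end.

Fixpoint Iprod (n d : nat) : d.-tuple EO -> (d.-tuple R -> R) -> R :=
  match d with
  | 0 => fun _ g => g [tuple]
  | d'.+1 => fun s g =>
      I1 (thead s) n (fun x : R =>
        Iprod n (behead_tuple s) (fun t : d'.-tuple R => g (@cons_tuple _ _ x t)))
  end.

Definition swap_sigma (d : nat) (s : d.-tuple EO) : d.-tuple EO :=
  map_tuple swapEO s.

Definition Isigma (n d : nat) (s : d.-tuple EO) (f : d.-tuple R -> R) : R :=
  Iprod n s f + Iprod n (swap_sigma s) f.

Definition G1 (s : EO) (n : nat) : seq R :=
  [seq cos (j%:R * pi / n%:R) | j <- iota 0 n.+1 &
     match s with E => ~~ odd j | O => odd j end].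

Fixpoint grid (n d : nat) : d.-tuple EO -> seq (d.-tuple R) :=
  match d with
  | 0 => fun _ => [:: [tuple]]
  | d'.+1 => fun s =>
      [seq @cons_tuple _ _ x t | x <- G1 (thead s) n,
                               t <- grid n (behead_tuple s)]
  end.

Definition num_nodes (n d : nat) (s : d.-tuple EO) : nat :=
  size (undup (grid n s ++ grid n (swap_sigma s))).

Definition peval (d : nat) (p : {mpoly R[d]}) (x : d.-tuple R) : R :=
  p.@[fun i => tnth x i].

(* total degree of p is at most k  <=>  msize p <= k + 1  (msize 0 = 0) *)
Definition tdeg_le (d : nat) (p : {mpoly R[d]}) (k : nat) : Prop :=
  (msize p <= k.+1)%N.

End Cubature.

(* Main.v *)
(** Let J k be the k-th moment of the one-dimensional Chebyshev weight. Since
    x^k is a combination of the T_l(x) = cos (l acos x), l <= k, and I^E, I^O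
    vanish on T_l for 0 < l < 2n, l <> n, and take opposite values on T_n, we get
    I^E x^k = I^O x^k = J k / 2 for k < n and I^E x^k + I^O x^k = J k for k < 2n.
    A monomial of total degree < 2n has at most one exponent >= n; all other
    coordinates contribute factors J/2 to both products, and the two values at
    the remaining coordinate add up to its moment.

    The moments of T_l come from the primitive - sin (l acos x) / l of
    T_l / sqrt (1 - x^2), applied to the nonnegative function 1 + T_l.

    Each one-dimensional grid has q or q + 1 points, q = n./2, and the two
    product grids are disjoint, so 2 q^d <= N <= 2 (q + 1)^d. *)
Require Import Defs.
From mathcomp Require Import all_boot all_order all_algebra.
From mathcomp Require Import all_classical all_reals all_analysis.
From mathcomp Require mpoly.
From mathcomp Require Import measurable_realfun ring lra zify.
Import Order.TTheory GRing.Theory Num.Theory.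
Import numFieldNormedType.Exports.
Local Open Scope ring_scope.

(** * One-dimensional functionals on Chebyshev polynomials *)

Section Quadrature.
Context {R : realType}.
Implicit Types (n k l m : nat) (s : EO) (h : R -> R).

Lemma cos_natpi l : cos (l%:R * pi) = (-1) ^+ l :> R.
Proof.
elim: l => [|l ih]; first by rewrite mul0r cos0.
by rewrite -natr1 mulrDl mul1r cosDpi ih exprS mulN1r.
Qed.

Lemma sin_natpi l : sin (l%:R * pi) = 0 :> R.
Proof.
elim: l => [|l ih]; first by rewrite mul0r sin0.
by rewrite -natr1 mulrDl mul1r sinDpi ih oppr0.
Qed.

Lemma cos_pow k : exists c : nat -> R, forall t : R,
  cos t ^+ k = \sum_(l < k.+1) c l * cos (l%:R * t).
Proof.
elim: k => [|k [c ih]].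
  by exists (fun=> 1) => t; rewrite big_ord1 mul0r cos0 mulr1.
(* p i = |i - 1|, from 2 cos t cos (i t) = cos ((i + 1) t) + cos ((i - 1) t) *)
pose p i := if i is i'.+1 then i' else 1%N.
exists (fun l => (\sum_(i < k.+1 | i.+1 == l) c i +
                  \sum_(i < k.+1 | p i == l) c i) / 2) => t.
(* Collects terms by frequency: the fibres of [f] partition the indices, and the bound on [f] keeps
   each frequency in range. *)
have E (f : 'I_k.+1 -> nat) : (forall i, f i < k.+2)%N ->
    \sum_(l < k.+2) (\sum_(i < k.+1 | f i == l) c i) * cos (l%:R * t) =
    \sum_(i < k.+1) c i * cos ((f i)%:R * t).
  move=> fk; under eq_bigr do rewrite big_distrl/=.
  rewrite (exchange_big_dep predT)//=; apply: eq_bigr => i _.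
  by rewrite (big_pred1 (Ordinal (fk i)))//= => j; rewrite eq_sym -val_eqE.
rewrite exprSr ih mulr_suml.
transitivity ((\sum_(i < k.+1) c i * cos (i.+1%:R * t) +
               \sum_(i < k.+1) c i * cos ((p i)%:R * t)) / 2).
  rewrite -big_split/= mulr_suml; apply: eq_bigr => -[[|i] ik] _ /=.
    by rewrite mul0r cos0 !mul1r/=; field.
  rewrite -[in i.+2%:R]natr1.
  rewrite (_ : i%:R * t = (i%:R + 1) * t - t); last by ring.
  rewrite (_ : (i.+1%:R + 1) * t = i.+1%:R * t + t); last by ring.
  by rewrite -natr1 cosB cosD; field.
symmetry; under eq_bigr do rewrite mulrAC mulrDl.
have p1 (i : 'I_k.+1) : (p i < k.+2)%N by case: i => -[|i]//= ik; rewrite ltnW// ltnW.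
by rewrite -mulr_suml big_split/= (E _ p1) (E (fun i => i.+1) (fun i => ltn_ord i)).
Qed.

(** The identification with the polynomial T_l is used only on [-1, 1], where [acos] inverts
    [cos]. *)
Definition cheb l (x : R) : R := cos (l%:R * acos x).

(** Take t = acos x in [cos_pow]. The coefficients do not depend on x, so linear functionals act
    term by term. *)
Lemma cheb_pow k : exists c : nat -> R, forall x, -1 <= x <= 1 ->
  x ^+ k = \sum_(l < k.+1) c l * cheb l x.
Proof.
have [c cE] := cos_pow k; exists c => x x1.
by rewrite -[in LHS](@acosK R x) ?in_itv.
Qed.

Lemma node_itv n j : (j <= n)%N -> (j%:R * pi / n%:R : R) \in `[0, pi].
Proof.
move=> jn; rewrite in_itv/= divr_ge0 ?mulr_ge0 ?pi_ge0//=.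
have [->|n0] := posnP n; first by rewrite invr0 mulr0 pi_ge0.
by rewrite ler_pdivrMr ?ltr0n// mulrC ler_wpM2l ?pi_ge0// ler_nat.
Qed.

(** Exchanging l and j makes the values at the nodes cosines in arithmetic progression, of step l pi
    / n. *)
Lemma cheb_node l n j : (j <= n)%N ->
  cheb l (cos (j%:R * pi / n%:R)) = cos (j%:R * (l%:R * pi / n%:R)).
Proof.
by move=> /node_itv jn; rewrite /cheb cosK//; congr cos; ring.
Qed.

Lemma chebN1 l : cheb l (-1) = (-1) ^+ l.
Proof. by rewrite /cheb acosN1 cos_natpi. Qed.

Lemma cheb1 l : cheb l 1 = 1.
Proof. by rewrite /cheb acos1 mulr0 cos0. Qed.

(** All nodes are cosines. This lets [I1] use the expansion of [cheb_pow], which holds on [-1, 1]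
    only. *)
Lemma I1_ext s n h h' : (forall x, -1 <= x <= 1 -> h x = h' x) ->
  I1 s n h = I1 s n h'.
Proof.
move=> hh'.
have E a (F : nat -> R) : \sum_(1 <= j < a) h (cos (F j)) =
                          \sum_(1 <= j < a) h' (cos (F j)).
  by apply: eq_bigr => j _; rewrite hh'// cos_geN1 cos_le1.
by case: s; rewrite /= /IE /IO !E !hh'//; lra.
Qed.

Lemma I1D s n h h' : I1 s n (fun x => h x + h' x) = I1 s n h + I1 s n h'.
Proof. by case: s; rewrite /= /IE /IO; case: ifP => _; rewrite !big_split/=; ring. Qed.

Lemma I1Z s n c h : I1 s n (fun x => c * h x) = c * I1 s n h.
Proof. by case: s; rewrite /= /IE /IO; case: ifP => _; rewrite -!mulr_sumr; ring. Qed.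

Lemma I1_sum s n (I : Type) (r : seq I) (c : I -> R) (h : I -> R -> R) :
  I1 s n (fun x => \sum_(i <- r) c i * h i x) = \sum_(i <- r) c i * I1 s n (h i).
Proof.
elim: r => [|a r ih].
  rewrite [X in _ = X]big_nil -[X in _ = X](mul0r (I1 s n (fun=> 0))) -I1Z; congr (I1 _ _ _).
  by apply/funext => x; rewrite big_nil mul0r.
rewrite big_cons -I1Z -ih -I1D; congr (I1 _ _ _).
by apply/funext => x; rewrite big_cons.
Qed.

(** In each parity case the weights, endpoints counting one half, add up to n / 2 before the
    division by n. *)
Lemma I1_cst s n (c : R) : (0 < n)%N -> I1 s n (fun=> c) = c / 2.
Proof.
move=> n0; have n00 : n%:R != 0 :> R by rewrite pnatr_eq0; lia.
have half_even : ~~ odd n -> n./2%:R = n%:R / 2 :> R.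
  by move=> on; rewrite (_ : n%:R = 2 * n./2%:R); [field|rewrite -natrM; congr _%:R; lia].
have half_odd : ~~ odd n = false -> n.+1./2%:R = (n%:R + 1) / 2 :> R.
  move=> on; rewrite natr1 (_ : n.+1%:R = 2 * n.+1./2%:R); first by field.
  by rewrite -natrM; congr _%:R; lia.
case: s; rewrite /= /IE /IO; case: ifP => on; rewrite !sumr_const_nat -[c *+ _]mulr_natr.
- by rewrite natrB ?half_even//; [field|lia].
- by rewrite natrB ?half_odd//; [field|lia].
- by rewrite subn1/= half_even//; field.
- by rewrite natrB ?half_odd//; [field|lia].
Qed.

(** Telescopes by 2 sin a cos b = sin (b + a) - sin (b - a), as does [sum_cos_even]. *)
Lemma sum_cos_odd (a : R) m :
  2 * sin a * (\sum_(1 <= j < m.+1) cos ((2 * j - 1)%:R * a)) = sin ((2 * m)%:R * a).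
Proof.
elim: m => [|m ih]; first by rewrite big_nil mul0r sin0 mulr0.
rewrite big_nat_recr//= mulrDr ih.
rewrite (_ : (2 * m.+1 - 1)%:R = (2 * m)%:R + 1); last by rewrite natr1; congr _%:R; lia.
rewrite (_ : (2 * m.+1)%:R = (2 * m)%:R + 1 + 1); last by rewrite !natr1; congr _%:R; lia.
set b := (_ + 1) * a.
rewrite (_ : (2 * m)%:R * a = b - a); last by rewrite /b; ring.
rewrite (_ : (_ + 1 + 1) * a = b + a); last by rewrite /b; ring.
by rewrite sinB sinD; ring.
Qed.

Lemma sum_cos_even (a : R) m :
  2 * sin a * (\sum_(1 <= j < m.+1) cos ((2 * j)%:R * a)) =
  sin ((2 * m).+1%:R * a) - sin a.
Proof.
elim: m => [|m ih]; first by rewrite big_nil mul1r subrr mulr0.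
rewrite big_nat_recr//= mulrDr ih.
rewrite (_ : (2 * m.+1).+1%:R = (2 * m)%:R + 1 + 1 + 1); last by rewrite !natr1; congr _%:R; lia.
rewrite (_ : (2 * m).+1%:R = (2 * m)%:R + 1); last by rewrite natr1.
rewrite (_ : (2 * m.+1)%:R = (2 * m)%:R + 1 + 1); last by rewrite !natr1; congr _%:R; lia.
set b := (_ + 1 + 1) * a.
rewrite (_ : (_ + 1 + 1 + 1) * a = b + a); last by rewrite /b; ring.
rewrite (_ : (_ + 1) * a = b - a); last by rewrite /b; ring.
by rewrite sinB sinD; ring.
Qed.

(** The angle lies in (0, pi), or in (pi, 2 pi) and is then shifted by pi. This allows dividing the
    closed forms of the cosine sums by sin a. *)
Lemma sin_neq0 n l : (0 < l < 2 * n)%N -> l != n -> sin (l%:R * pi / n%:R) != 0 :> R.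
Proof.
move=> /andP[l0 l2n] ln; have n0 : 0 < n%:R :> R by rewrite ltr0n; lia.
have pos k : (0 < k < n)%N -> 0 < sin (k%:R * pi / n%:R) :> R.
  move=> /andP[k0 kn]; rewrite sin_gt0_pi// divr_gt0 ?mulr_gt0 ?pi_gt0 ?ltr0n//; try lia.
  by rewrite ltr_pdivrMr// mulrC ltr_pM2l ?pi_gt0// ltr_nat.
have [ltn|nl] := ltnP l n; first by rewrite lt0r_neq0 ?pos ?l0.
rewrite (_ : l%:R * pi / n%:R = (l - n)%:R * pi / n%:R + pi).
  by rewrite sinDpi oppr_eq0 lt0r_neq0// pos//; lia.
by rewrite natrB//; field; rewrite lt0r_neq0.
Qed.

(** In all four cases the closed form of the interior sum is minus the half-weighted endpoint
    values. *)
Lemma I1_cheb s n l : (0 < l < 2 * n)%N -> l != n -> I1 s n (cheb l) = 0.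
Proof.
move=> ln2 ln; have n0 : (0 < n)%N by lia.
have sa := sin_neq0 _ _ ln2 ln; set a := l%:R * pi / n%:R in sa.
have na : n%:R * a = l%:R * pi by rewrite /a; field; rewrite pnatr_eq0; lia.
(* For the two cases where the telescoped sum ends at frequency n - 1: E with n even and O with n
   odd. The other two end at n, where the sine vanishes. *)
have npa : sin (n.-1%:R * a) = - ((-1) ^+ l * sin a).
  rewrite -subn1 natrB// mulrBl na mul1r sinB sin_natpi cos_natpi; ring.
have node (F : nat -> nat) b : (forall j, (1 <= j < b)%N -> (F j <= n)%N) ->
    \sum_(1 <= j < b) cheb l (cos ((F j)%:R * pi / n%:R)) =
    \sum_(1 <= j < b) cos ((F j)%:R * a).
  by move=> Fn; apply: eq_big_nat => j /Fn jn; rewrite cheb_node.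
have sa2 : 2 * sin a != 0 by rewrite mulf_neq0 ?pnatr_eq0.
have n00 : n%:R != 0 :> R by rewrite pnatr_eq0; lia.
case: s; rewrite /= /IE /IO; case: ifP => on;
  rewrite ?(node (fun j => 2 * j)%N) ?(node (fun j => 2 * j - 1)%N)
    ?chebN1 ?cheb1; try by move=> j; lia.
- have := sum_cos_even a n./2.-1; rewrite prednK; last by lia.
  rewrite (_ : (2 * n./2.-1).+1 = n.-1); last by lia.
  by rewrite npa => /(canRL (mulKf sa2)) ->; field; rewrite n00 sa.
- have := sum_cos_even a n.+1./2.-1; rewrite prednK; last by lia.
  rewrite (_ : (2 * n.+1./2.-1).+1 = n); last by lia.
  by rewrite na sin_natpi => /(canRL (mulKf sa2)) ->; field; rewrite n00 sa.
- have := sum_cos_odd a n./2.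
  rewrite (_ : (2 * n./2)%N = n); last by lia.
  by rewrite na sin_natpi => /(canRL (mulKf sa2)) ->; field; rewrite n00 sa.
- have := sum_cos_odd a n.+1./2.-1; rewrite prednK; last by lia.
  rewrite (_ : (2 * n.+1./2.-1)%N = n.-1); last by lia.
  by rewrite npa => /(canRL (mulKf sa2)) ->; field; rewrite n00 sa.
Qed.

Lemma I1_cheb0 s n : (0 < n)%N -> I1 s n (cheb 0) = 2^-1.
Proof.
move=> n0; rewrite (I1_ext _ _ _ (fun=> 1)) ?I1_cst ?mul1r// => x _.
by rewrite /cheb mul0r cos0.
Qed.

Lemma I1_cheb_EO n : (0 < n)%N -> I1 E n (cheb n) + I1 O n (cheb n) = 0.
Proof.
move=> n0; have n00 : n%:R != 0 :> R by rewrite pnatr_eq0; lia.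
have a : n%:R * pi / n%:R = pi :> R by field.
have E1 b : (b.-1.*2 <= n)%N ->
    \sum_(1 <= j < b) cheb n (cos ((2 * j)%:R * pi / n%:R)) = \sum_(1 <= j < b) 1.
  move=> bn; apply: eq_big_nat => j jb; rewrite cheb_node ?a; last by lia.
  by rewrite cos_natpi mulnC exprM sqrr_sign.
have O1 b : (b.-1.*2 <= n.+1)%N ->
    \sum_(1 <= j < b) cheb n (cos ((2 * j - 1)%:R * pi / n%:R)) = \sum_(1 <= j < b) (-1).
  move=> bn; apply: eq_big_nat => j jb; rewrite cheb_node ?a; last by lia.
  by rewrite cos_natpi -signr_odd (_ : odd _ = true)//; lia.
(* T_n equals (-1)^j at the node of index j, so it is constant on each of the two grids. *)
suff [-> ->] : I1 E n (cheb n) = I1 E n (fun=> 1) /\ I1 O n (cheb n) = I1 O n (fun=> -1).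
  by rewrite !I1_cst//; ring.
have sE : (-1) ^+ n = if ~~ odd n then 1 else -1 :> R by rewrite -signr_odd; case: odd.
by split; rewrite /= /IE /IO; case: ifP => on; rewrite ?E1 ?O1 ?chebN1 ?cheb1 ?sE ?on//; lia.
Qed.
End Quadrature.

(** * Moments of the one-dimensional Chebyshev weight *)

Section Moments.
Context {R : realType}.
Implicit Types (n k l m : nat) (g G : R -> R).
Notation mu := (@lebesgue_measure R).
Local Open Scope classical_set_scope.

(** The substitution x = cos t in terms of primitives; the sign cancels that of the derivative of
    [acos]. *)
Lemma is_derive_comp_acos (x : R) G (y : R) : -1 < x < 1 ->
  is_derive (acos x) 1 G y ->
  is_derive x 1 (fun x => - G (acos x)) (y * (Num.sqrt (1 - x ^+ 2))^-1).
Proof.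
move=> x1 dG; have dA := is_derive1_acos x1.
have -> : y * (Num.sqrt (1 - x ^+ 2))^-1 = - (y * - (Num.sqrt (1 - x ^+ 2))^-1).
  by rewrite mulrN opprK.
by apply: is_deriveN; exact: is_derive1_comp.
Qed.

Lemma continuous_comp_acos g : continuous g ->
  {in `](-1 : R), 1[%classic, continuous (fun x => g (acos x) * (Num.sqrt (1 - x ^+ 2))^-1)}.
Proof.
move=> cg x /[!inE]/= /[!in_itv]/= /andP[x1 x2].
apply: (@continuousM _ _ (g \o acos) (fun x => (Num.sqrt (1 - x ^+ 2))^-1)).
  apply: continuous_comp; last exact: cg.
  by apply: continuous_acos; rewrite x1.
apply: continuousV; first by rewrite sqrtr_eq0 -ltNge; nra.
have c : {for x, continuous (fun y : R => 1 - y ^+ 2)}.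
  by apply: continuousB; [exact: cvg_cst|exact: exprn_continuous].
exact: (continuous_comp c (@sqrt_continuous R _)).
Qed.

Lemma measurable_comp_acos g : continuous g ->
  measurable_fun `]-1 : R, 1 : R[ (fun x : R => (g (acos x) * (Num.sqrt (1 - x ^+ 2))^-1)%:E).
Proof.
move=> cg; apply/measurable_EFinP; apply: open_continuous_measurable_fun.
  by apply: interval_open.
exact: continuous_comp_acos.
Qed.

(* Exhausting ]-1, 1[ by the intervals [-cos e_n, cos e_n], on whose endpoints
   acos is pi - e_n and e_n, avoids taking limits of acos at -1 and 1. *)
Let e n : R := pi / n.+3%:R.

(** The shift [n.+3] keeps e_n below pi / 2 already at n = 0, so that cos e_n > 0 and [J n] is
    nondegenerate. *)
Let e_itv n : 0 < e n < pi / 2.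
Proof.
rewrite divr_gt0 ?pi_gt0//= ltr_pM2l ?pi_gt0// ltf_pV2 ?posrE//.
by rewrite ltr_nat.
Qed.

Let e_dec m n : (m <= n)%N -> e n <= e m.
Proof.
move=> mn; rewrite ler_pM2l ?pi_gt0// lef_pV2 ?posrE// ler_nat; lia.
Qed.

Let J n : set R := `[- cos (e n), cos (e n)].

Let cos_piB (t : R) : - cos t = cos (pi - t).
Proof. by rewrite cosB cospi sinpi; ring. Qed.

Let ler_cos (s t : R) : 0 <= s <= pi -> 0 <= t <= pi -> (cos s <= cos t) = (t <= s).
Proof. by move=> s0 t0; rewrite !leNgt ltr_cos ?in_itv. Qed.

Let itv_bigcup : `](-1 : R), 1[%classic = \bigcup_n J n.
Proof.
apply/seteqP; split => x; rewrite /J /=.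
  rewrite in_itv/= => /andP[x0 x1].
  have a0 : 0 < acos x by rewrite acos_gt0// x1 ltW.
  have ap : acos x < pi by rewrite acos_ltpi// x0 ltW.
  (* The distance from acos x to the ends of [0, pi]; x lies in [J N] as soon as e_N <= d. *)
  pose d := Num.min (acos x) (pi - acos x).
  have d0 : 0 < d by rewrite /d lt_min a0 subr_gt0.
  pose N := Num.truncn (pi / d).
  have eN : e N <= d.
    rewrite /e ler_pdivrMr// mulrC -ler_pdivrMr//.
    apply: ltW; apply: (lt_le_trans (truncnS_gt _)); rewrite ler_nat -/N; lia.
  exists N => //=; rewrite in_itv/=.
  have := e_itv N; move: eN; rewrite /d le_min => /andP[e1 e2] /andP[e3 e4].
  have -> : x = cos (acos x) by rewrite acosK// in_itv/= !ltW.
  by rewrite cos_piB !ler_cos; lra.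
move=> [N _]/=; rewrite !in_itv/= => /andP[x0 x1].
have /andP[e0 e1] := e_itv N.
have c1 : cos (e N) < 1 by rewrite -cos0 ltr_cos ?in_itv/=; lra.
lra.
Qed.

(** The fundamental theorem of calculus on [J n] gives G (pi - e_n) - G (e_n). Since g >= 0,
    monotone convergence passes to the union of the [J n], while continuity of G gives the limit of
    the values. *)
Lemma ge0_integral_comp_acos g G : continuous g ->
  (forall t : R, is_derive t (1 : R) G (g t)) -> (forall t : R, 0 <= t <= pi -> 0 <= g t) ->
  (\int[mu]_(x in `](-1)%R, 1%R[) (g (acos x) * (Num.sqrt (1 - x ^+ 2))^-1)%:E =
   (G pi - G 0)%:E)%E.
Proof.
move=> cg dG g0; pose f (x : R) := g (acos x) * (Num.sqrt (1 - x ^+ 2))^-1.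
rewrite -[LHS]/(integral mu `](-1)%R, 1%R[ (fun x => (f x)%:E)).
have mf := measurable_comp_acos _ cg.
pose F (x : R) := - G (acos x).
have cG : continuous G.
  move=> t; apply: differentiable_continuous; apply/derivable1_diffP.
  exact: (@ex_derive _ _ _ _ _ _ _ (dG t)).
have dF (x : R) : -1 < x < 1 -> is_derive x (1 : R) F (f x).
  by move=> x1; apply: is_derive_comp_acos.
have cF (x : R) : -1 < x < 1 -> {for x, continuous F}.
  move=> x1; apply: differentiable_continuous; apply/derivable1_diffP.
  exact: (@ex_derive _ _ _ _ _ _ _ (dF _ x1)).
have cN n : -1 < - cos (e n) /\ cos (e n) < 1 /\ - cos (e n) < cos (e n).
  have /andP[e0 e1] := e_itv n.
  have c1 : cos (e n) < 1 by rewrite -cos0 ltr_cos ?in_itv/=; lra.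
  have c2 : 0 < cos (e n) by rewrite cos_gt0_pihalf; lra.
  lra.
have intJ n : (\int[mu]_(x in J n) (f x)%:E = (G (pi - e n) - G (e n))%:E)%E.
  have [c1 [c2 c3]] := cN n; have /andP[e0 e1] := e_itv n.
  rewrite (@continuous_FTC2 _ f F)//.
  - rewrite /F cos_piB !cosK ?in_itv/=; [|lra|lra].
    by rewrite -EFinB opprK addrC.
  - apply: continuous_in_subspaceT => x /[!inE]/= /[!in_itv]/= xn.
    by apply: continuous_comp_acos => //; rewrite inE/= in_itv/=; lra.
  - split.
    + move=> x /[!in_itv]/= xn.
      by apply: (@ex_derive _ _ _ _ _ _ _ (dF x _)); lra.
    + by apply/cvg_at_right_filter/cF; lra.
    + by apply/cvg_at_left_filter/cF; lra.
  - move=> x /[!in_itv]/= xn; rewrite derive1E.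
    by apply: (@derive_val _ _ _ _ _ _ _ (dF x _)); lra.
have cv : ((fun n => \int[mu]_(x in J n) (f x)%:E) @ \oo -->
           \int[mu]_(x in `](-1)%R, 1%R[) (f x)%:E)%E.
  rewrite itv_bigcup; apply: ge0_nondecreasing_set_cvg_integral => //.
  - apply/nondecreasing_seqP => n; rewrite subsetEset => x; rewrite /J/= !in_itv/=.
    have := e_itv n; have := e_itv n.+1; have := e_dec _ _ (leqnSn n) => ee e1 e2.
    have : cos (e n) <= cos (e n.+1) by rewrite ler_cos; lra.
    by move=> *; lra.
  - by move=> n; exact: measurable_itv.
  - move=> n; apply: measurable_funS mf => //.
    by rewrite itv_bigcup; exact: bigcup_sup.
  - move=> n x; rewrite /J/= in_itv/= => xn; rewrite lee_fin mulr_ge0 ?invr_ge0 ?sqrtr_ge0//.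
    by have := cN n; move=> cn; rewrite g0// acos_ge0 ?acos_lepi//; lra.
have e_0 : e n @[n --> \oo] --> (0 : R).
  rewrite -(mulr0 pi); apply: cvgM; first exact: cvg_cst.
  (* The harmonic sequence is 1 / (n + 1); shifting it by 2 gives 1 / (n + 3). *)
  have := @cvg_harmonic R; rewrite -(cvg_shiftn 2)/= /harmonic.
  by under eq_fun do rewrite addn2.
rewrite (funext intJ) in cv.
apply: (cvg_unique _ cv); first exact: ereal_hausdorff.
apply: cvg_EFin; first exact: nearW.
apply: cvgB.
  apply: (@continuous_cvg _ _ _ _ _ (fun n => pi - e n) G); first exact: cG.
  by rewrite -[X in _ --> X](subr0 pi); apply: cvgB => //; exact: cvg_cst.
by apply: (@continuous_cvg _ _ _ _ _ e G) => //; exact: cG.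
Qed.

Lemma ge0_integrable_comp_acos g G : continuous g ->
  (forall t : R, is_derive t (1 : R) G (g t)) ->
  (forall t : R, 0 <= t <= pi -> 0 <= g t) ->
  mu.-integrable `]-1 : R, 1 : R[ (fun x : R => (g (acos x) * (Num.sqrt (1 - x ^+ 2))^-1)%:E).
Proof.
move=> cg dG g0; apply/integrableP; split; first exact: measurable_comp_acos.
have e1 := ge0_integral_comp_acos _ _ cg dG g0.
rewrite -[X in (X < _)%E]/(integral mu _ _) (_ : integral mu _ _ = (G pi - G 0)%:E) ?ltry//.
rewrite -e1; apply: eq_integral => x /[!inE]/= /[!in_itv]/= x1.
rewrite ger0_norm// mulr_ge0 ?invr_ge0 ?sqrtr_ge0//.
by rewrite g0// acos_ge0 ?acos_lepi//; lra.
Qed.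

(** The endpoints are null. Leads from the open interval, where [acos] is differentiable, to the
    closed one of [cube_integral]. *)
Lemma integrable_itv_oocc (a b : R) (f : R -> \bar R) :
  mu.-integrable `]a, b[ f -> mu.-integrable `[a, b] f.
Proof.
move=> /integrableP[mf foo]; apply/integrableP; split.
  exact: emeasurable_fun_itv_cc mf.
by rewrite integral_itv_bndoo//; exact: measurableT_comp.
Qed.

Lemma integral_cheb l :
  mu.-integrable `[(-1)%R, 1%R] (fun x : R => (cheb l x * (Num.sqrt (1 - x ^+ 2))^-1)%:E) /\
  (\int[mu]_(x in `[(-1)%R, 1%R]) (cheb l x * (Num.sqrt (1 - x ^+ 2))^-1)%:E =
   (if l == 0 then pi else 0)%:E)%E.
Proof.
pose s (x : R) := (Num.sqrt (1 - x ^+ 2))^-1.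
have c1 : continuous (fun _ : R => 1 : R) by move=> x; exact: cvg_cst.
have d1 (t : R) : is_derive t (1 : R) id (1 : R) by exact: is_derive_id.
have p1 (t : R) : 0 <= t <= pi -> 0 <= (1 : R) by [].
have i1 := ge0_integrable_comp_acos _ _ c1 d1 p1.
have e1 := ge0_integral_comp_acos _ _ c1 d1 p1; rewrite subr0 in e1.
suff [il el] : mu.-integrable `]-1 : R, 1 : R[ (fun x : R => (cheb l x * s x)%:E) /\
    (\int[mu]_(x in `](-1)%R, 1%R[) (cheb l x * s x)%:E = (if l == 0 then pi else 0)%:E)%E.
  split; first exact: integrable_itv_oocc.
  by rewrite integral_itv_bndoo//; case/integrableP : il.
have [->|l0] := eqVneq l 0.
  suff -> : (fun x : R => (cheb 0 x * s x)%:E) = (fun x : R => (1 * s x)%:E) by [].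
  by apply/funext => x; rewrite /cheb mul0r cos0.
have l00 : l%:R != 0 :> R by rewrite pnatr_eq0.
(* T_l changes sign, so 1 is added to reach the nonnegative case. The primitive t + sin (l t) / l
   grows by pi over [0, pi], as does that of 1, so the difference is 0. *)
pose g (t : R) := 1 + cos (l%:R * t).
have dl (t : R) : is_derive t (1 : R) (fun u : R => l%:R * u) l%:R.
  by rewrite -[X in is_derive _ _ _ X]mulr1; exact: is_deriveZ.
have cg : continuous g.
  move=> t; apply: cvgD; first exact: cvg_cst.
  apply: (@continuous_comp _ _ _ (fun u : R => l%:R * u) cos); last exact: continuous_cos.
  by apply: cvgM; [exact: cvg_cst|exact: cvg_id].
have dg (t : R) : is_derive t (1 : R) (fun t => t + l%:R^-1 * sin (l%:R * t)) (g t).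
  apply: is_deriveD.
  have := is_derive1_comp (is_derive_sin (l%:R * t)) (dl t) => ds.
  rewrite (_ : cos _ = l%:R^-1 * (cos (l%:R * t) * l%:R)); last by field.
  exact: is_deriveZ.
have pg (t : R) : 0 <= t <= pi -> 0 <= g t.
  by move=> _; rewrite /g -lerBlDl sub0r cos_geN1.
have ig := ge0_integrable_comp_acos _ _ cg dg pg.
have eg := ge0_integral_comp_acos _ _ cg dg pg.
rewrite mulr0 sin0 sin_natpi !mulr0 !addr0 subr0 in eg.
have E : (fun x : R => (cheb l x * s x)%:E) =
         (fun x : R => (g (acos x) * s x)%:E - (1 * s x)%:E)%E.
  by apply/funext => x; rewrite -EFinB /g /cheb; congr (_%:E); ring.
rewrite E; split; first exact: integrableB.
rewrite integralB//= [X in (X - _)%E]eg [X in (_ - X)%E]e1.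
by rewrite -EFinB subrr.
Qed.

(** A single J, chosen before n, serves the integral and all the quadratures, because the Chebyshev
    coefficients of x^k do not involve n. *)
Lemma integral_monomial k : exists J : R,
  [/\ mu.-integrable `[(-1)%R, 1%R]
        (fun x : R => (x ^+ k * (pi^-1 * (Num.sqrt (1 - x ^+ 2))^-1))%:E),
      (\int[mu]_(x in `[(-1)%R, 1%R])
        (x ^+ k * (pi^-1 * (Num.sqrt (1 - x ^+ 2))^-1))%:E = J%:E)%E,
      forall n s, (k < n)%N -> I1 s n (fun x => x ^+ k) = J / 2 &
      forall n, (0 < n)%N -> (k < 2 * n)%N ->
        I1 E n (fun x => x ^+ k) + I1 O n (fun x => x ^+ k) = J].
Proof.
have [c cE] := @cheb_pow R k.
pose h l (x : R) := ((pi^-1 * c l)%:E * (cheb l x * (Num.sqrt (1 - x ^+ 2))^-1)%:E)%E.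
have hE (x : R) : x \in `[(-1)%R, 1%R] ->
    (x ^+ k * (pi^-1 * (Num.sqrt (1 - x ^+ 2))^-1))%:E = (\sum_(l < k.+1) h l x)%E.
  move=> /[!inE]/= /[!in_itv]/= x1.
  rewrite (eq_bigr (fun l : 'I_k.+1 =>
    (pi^-1 * c l * (cheb l x * (Num.sqrt (1 - x ^+ 2))^-1))%:E)) ?sumEFin//.
  by rewrite cE// mulr_suml; congr EFin; apply: eq_bigr => l _; ring.
have hi l : mu.-integrable `[(-1)%R, 1%R] (h l).
  by apply: integrableZl => //; case: (integral_cheb l).
(* The coefficient of T_0: the other T_l integrate to 0, and pi^-1 normalizes the integral of T_0 to
   1. *)
exists (c 0); split.
- apply: (@eq_integrable _ _ _ mu _ (measurable_itv _) (fun x : R => (\sum_(l < k.+1) h l x)%E)).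
    by move=> x x1; rewrite hE.
  exact: integrable_sum.
- transitivity (\int[mu]_(x in `[(-1)%R, 1%R]) (\sum_(l < k.+1) h l x))%E.
    by apply: eq_integral => x x1; rewrite hE.
  rewrite integral_sum//= big_ord_recl/= big1 => [|l _].
    rewrite /h integralZl//; last by case: (integral_cheb 0).
    case: (integral_cheb 0) => _ -> /=.
    by rewrite adde0 -EFinM; congr EFin; rewrite mulrAC mulVf ?mul1r// lt0r_neq0 ?pi_gt0.
  rewrite /h integralZl//; last by case: (integral_cheb (bump 0 l)).
  by case: (integral_cheb (bump 0 l)) => _ -> /=; rewrite mule0.
- move=> n s kn; rewrite (I1_ext _ _ _ _ cE) I1_sum big_ord_recl/= I1_cheb0; last by lia.
  rewrite big1 ?addr0// => -[l /= lk] _.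
  by rewrite I1_cheb ?mulr0//= /bump/=; lia.
- move=> n n0 kn; rewrite !(I1_ext _ _ _ _ cE) !I1_sum -big_split big_ord_recl.
  rewrite !I1_cheb0// big1 => [|[l lk] _]; first by move=> /=; field.
  transitivity (c l.+1 * I1 E n (cheb l.+1) + c l.+1 * I1 O n (cheb l.+1)) => //.
  (* T_n cancels only between the two functionals; every other T_l is killed by each of them. *)
  rewrite -mulrDr; have [->|ln] := eqVneq l.+1 n.
    by rewrite I1_cheb_EO ?mulr0.
  by rewrite !I1_cheb ?addr0 ?mulr0//; lia.
Qed.
End Moments.

(** * Iterated integrals and sums of separated functions *)

Section Cubature.
Context {R : realType}.
Notation mu := (@lebesgue_measure R).

Lemma tnth_cons0 (T : Type) d (x : T) (t : d.-tuple T) : tnth (cons_tuple x t) ord0 = x.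
Proof. by []. Qed.

Lemma tnth_consS (T : Type) d (x : T) (t : d.-tuple T) (i : 'I_d) :
  tnth (cons_tuple x t) (lift ord0 i) = tnth t i.
Proof. by rewrite (tnth_nth x)/= -tnth_nth. Qed.

Lemma tnth_behead_lift (T : Type) d (s : d.+1.-tuple T) (i : 'I_d) :
  tnth (behead_tuple s) i = tnth s (lift ord0 i).
Proof.
by case/tupleP: s => x t; rewrite tnth_consS; congr tnth; apply: val_inj.
Qed.

(** Treating whole sums of products avoids a separate linearity result for the iterated integral:
    the induction varies c, which absorbs the factor in the outer variable. *)
Lemma cube_integral_sum_prod (u : nat -> R -> R) (J : nat -> R) :
    (forall k, mu.-integrable `[(-1)%R, 1%R]%classic (fun x => (u k x)%:E)) ->
    (forall k, (\int[mu]_(x in `[(-1)%R, 1%R]) (u k x)%:E)%E = (J k)%:E) ->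
  forall (I : Type) (r : seq I) d (c : I -> R) (e : I -> 'I_d -> nat),
  cube_integral (fun x : d.-tuple R =>
    \sum_(a <- r) c a * \prod_(i < d) u (e a i) (tnth x i)) =
  (\sum_(a <- r) c a * \prod_(i < d) J (e a i))%:E.
Proof.
move=> iu uJ I r; elim=> [|d ih] c e /=.
  by congr (_%:E); apply: eq_bigr => a _; rewrite !big_ord0.
pose P a := \prod_(i < d) J (e a (lift ord0 i)).
transitivity (\int[mu]_(x in `[(-1)%R, 1%R])
    (\sum_(a <- r) (c a * P a)%:E * (u (e a ord0) x)%:E))%E; last first.
  rewrite integral_sum//= => [|a]; last exact: integrableZl.
  rewrite -sumEFin; apply: eq_bigr => a _.
  by rewrite integralZl// uJ -EFinM big_ord_recl /P; congr EFin; ring.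
apply: eq_integral => x _.
transitivity (\sum_(a <- r) c a * u (e a ord0) x * P a)%:E.
  rewrite -(ih (fun a => c a * u (e a ord0) x) (fun a i => e a (lift ord0 i))).
  congr cube_integral; apply/funext => t; apply: eq_bigr => a _.
  by rewrite big_ord_recl/= mulrA; congr (_ * _); apply: eq_bigr => i _; rewrite tnth_consS.
by rewrite -sumEFin; apply: eq_bigr => a _; rewrite -EFinM; congr EFin; ring.
Qed.

(** The same induction, with [I1_sum] in place of linearity of the integral. *)
Lemma Iprod_sum_prod n (u : nat -> R -> R) (I : Type) (r : seq I) d (s : d.-tuple EO)
    (c : I -> R) (e : I -> 'I_d -> nat) :
  Iprod n s (fun x : d.-tuple R => \sum_(a <- r) c a * \prod_(i < d) u (e a i) (tnth x i)) =
  \sum_(a <- r) c a * \prod_(i < d) I1 (tnth s i) n (u (e a i)).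
Proof.
elim: d s c e => [|d ih] s c e /=.
  by apply: eq_bigr => a _; rewrite !big_ord0.
pose P a := \prod_(i < d) I1 (tnth s (lift ord0 i)) n (u (e a (lift ord0 i))).
transitivity (I1 (thead s) n (fun x => \sum_(a <- r) (c a * P a) * u (e a ord0) x)).
  congr (I1 _ _ _); apply/funext => x.
  transitivity (\sum_(a <- r) c a * u (e a ord0) x * P a); last first.
    by apply: eq_bigr => a _; ring.
  transitivity (\sum_(a <- r) c a * u (e a ord0) x *
      \prod_(i < d) I1 (tnth (behead_tuple s) i) n (u (e a (lift ord0 i)))).
    rewrite -ih; congr Iprod; apply/funext => t; apply: eq_bigr => a _.
    by rewrite big_ord_recl/= mulrA; congr (_ * _); apply: eq_bigr => i _; rewrite tnth_consS.
  by apply: eq_bigr => a _; congr (_ * _); apply: eq_bigr => i _; rewrite tnth_behead_lift.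
rewrite I1_sum; apply: eq_bigr => a _; rewrite big_ord_recl /P /thead; ring.
Qed.

Lemma moment_prod n d (J A B : nat -> R) (m : 'I_d -> nat) (s : d.-tuple EO) : (1 <= d)%N ->
  (\sum_i m i < 2 * n)%N ->
  (forall k s0, (k < n)%N -> I1 s0 n (fun x : R => x ^+ k) = J k / 2) ->
  (forall k, (k < 2 * n)%N ->
     I1 E n (fun x : R => x ^+ k) + I1 O n (fun x : R => x ^+ k) = J k) ->
  \prod_i J (m i) = 2 ^+ (d - 1) *
    (\prod_i I1 (tnth s i) n (fun x => x ^+ m i) +
     \prod_i I1 (tnth (swap_sigma s) i) n (fun x => x ^+ m i)).
Proof.
case: d m s => // d m s _ mn Jn J2n.
(* Only the largest exponent can reach n: at i0 the two functionals add up to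
   the moment, at the other indices each of them gives half of it. *)
pose i0 := [arg max_(i > ord0) m i]%N.
have m0 i : (m i <= m i0)%N by rewrite /i0; case: arg_maxnP => // i1 _; apply.
(* Otherwise m i and m i0 would both be at least n, and their sum at least 2n. *)
have mni i : i != i0 -> (m i < n)%N.
  move=> ii0; move: mn (m0 i); rewrite (bigD1 i0)//= (bigD1 i)//=; lia.
have half (s1 : d.+1.-tuple EO) : \prod_(i | i != i0) I1 (tnth s1 i) n (fun x => x ^+ m i) =
    (\prod_(i | i != i0) J (m i)) / 2 ^+ d.
  transitivity (\prod_(i | i != i0) (J (m i) * 2^-1)).
    by apply: eq_bigr => i /mni; exact: Jn.
  by rewrite big_split/= prodr_const cardC1 card_ord exprVn.
rewrite (bigD1 i0)//= [X in _ * (X + _)](bigD1 i0)//= [X in _ * (_ + X)](bigD1 i0)//=.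
rewrite !half -mulrDl -(J2n (m i0)); last first.
  by move: mn; rewrite (bigD1 i0)//=; lia.
(* The dimension is now [d.+1], so 2 ^+ d offsets the d halves; at i0 the two tuples give E and O in
   some order. *)
rewrite tnth_map subn1/=; have d2 : (2 ^+ d : R) != 0 by rewrite expf_neq0.
by case: (tnth s i0) => /=; field.
Qed.

End Cubature.

(** * Counting the nodes *)

Section Nodes.
Context {R : realType}.

Lemma node_inj n : (0 < n)%N ->
  {in iota 0 n.+1 &, injective (fun j : nat => cos (j%:R * pi / n%:R) : R)}.
Proof.
move=> n0 i j; rewrite !mem_iota !add0n !ltnS /= => ni nj.
move=> /(cos_inj (node_itv _ _ ni) (node_itv _ _ nj)) /eqP.
have nn : n%:R != 0 :> R by rewrite pnatr_eq0; lia.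
rewrite (inj_eq (mulIf (invr_neq0 nn))) (inj_eq (mulIf (lt0r_neq0 (pi_gt0 R)))).
by rewrite eqr_nat => /eqP.
Qed.

Lemma G1_uniq s n : (0 < n)%N -> uniq (G1 R s n).
Proof.
move=> n0; rewrite map_inj_in_uniq ?filter_uniq ?iota_uniq// => i j.
by rewrite !mem_filter => /andP[_ ni] /andP[_ nj]; exact: node_inj.
Qed.

Lemma G1_disjoint s n x : (0 < n)%N -> x \in G1 R s n -> x \in G1 R (swapEO s) n -> False.
Proof.
move=> n0 /mapP[i + ->] /mapP[j + /(node_inj _ n0)]; rewrite !mem_filter.
by move=> /andP[iE ni] /andP[jE nj] /(_ ni nj) ij; move: iE jE; rewrite ij; case: s; case: odd.
Qed.

Lemma size_G1 s n : (n./2 <= size (G1 R s n) <= n./2.+1)%N.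
Proof.
rewrite size_map size_filter; set p := fun _ => _.
(* The numbers of even and of odd indices in 0, ..., n. *)
have -> : count p (iota 0 n.+1) = (if s is E then n./2.+1 else uphalf n).
  rewrite /p; elim: n => [|n ih]; first by case: s {p}.
  by rewrite -addn1 iotaD count_cat ih/=; case: s {p ih} => /=; lia.
by case: s {p}; lia.
Qed.

Lemma size_grid n d (s : d.-tuple EO) :
  size (grid R n s) = (\prod_(i < d) size (G1 R (tnth s i) n))%N.
Proof.
elim: d s => [|d ih] s /=; first by rewrite big_ord0.
rewrite size_allpairs ih big_ord_recl; congr (_ * _)%N.
by apply: eq_bigr => i _; rewrite tnth_behead_lift.
Qed.

Lemma grid_uniq n d (s : d.-tuple EO) : (0 < n)%N -> uniq (grid R n s).
Proof.
move=> n0; elim: d s => [|d ih] s //=.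
apply: allpairs_uniq; [exact: G1_uniq|exact: ih|].
move=> [x t] [y u] _ _ /= xy.
have -> : x = y by have := congr1 (fun z => tnth z ord0) xy; rewrite /= !tnth_cons0.
by congr pair; apply: eq_from_tnth => i; rewrite -(tnth_consS _ _ x t) -(tnth_consS _ _ y u) xy.
Qed.

(** The first coordinates already differ; in dimension 0 both grids would be the single empty
    tuple. *)
Lemma grid_disjoint n d (s : d.+1.-tuple EO) x : (0 < n)%N ->
  x \in grid R n s -> x \in grid R n (swap_sigma s) -> False.
Proof.
move=> n0 /= /allpairsP[[y t] /= [y1 _ ->]] /allpairsP[[z u] /= [z1 _ yz]].
apply: (G1_disjoint _ _ _ n0 y1).
have -> : y = z by have := congr1 (fun z => tnth z ord0) yz; rewrite !tnth_cons0.
by move: z1; rewrite /thead tnth_map.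
Qed.

Lemma num_nodesE n d (s : d.-tuple EO) : (0 < n)%N -> (1 <= d)%N ->
  num_nodes R n s = (size (grid R n s) + size (grid R n (swap_sigma s)))%N.
Proof.
case: d s => // d s n0 _; rewrite /num_nodes undup_id ?size_cat//.
rewrite cat_uniq !grid_uniq//= andbT; apply/hasPn => x xs; apply/negP => xs'.
exact: grid_disjoint n0 xs' xs.
Qed.

Lemma num_nodes_bounds n d (s : d.-tuple EO) : (0 < n)%N -> (1 <= d)%N ->
  (2 * n./2 ^ d <= num_nodes R n s <= 2 * n./2.+1 ^ d)%N.
Proof.
move=> n0 d1; rewrite num_nodesE// !size_grid.
have b (s' : d.-tuple EO) :
    (n./2 ^ d <= \prod_(i < d) size (G1 R (tnth s' i) n) <= n./2.+1 ^ d)%N.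
  have cst m : (m ^ d = \prod_(i < d) m)%N by rewrite prod_nat_const card_ord.
  by rewrite !cst; apply/andP; split; apply: leq_prod => i _; case/andP: (size_G1 (tnth s' i) n).
by have := b s; have := b (swap_sigma s); lia.
Qed.

(** The right-hand side is the chord over [0, 1] of a convex function. The induction step has slack
    (2^d - 1) x (1 - x). *)
Lemma exprD1_le d (x : R) : 0 <= x <= 1 -> (1 + x) ^+ d <= 1 + (2 ^+ d - 1) * x.
Proof.
move=> x01; elim: d => [|d ih]; first by rewrite !expr0; lra.
have d2 : 1 <= 2 ^+ d :> R by rewrite exprn_ege1//; lra.
rewrite !exprS; apply: (@le_trans _ _ ((1 + x) * (1 + (2 ^+ d - 1) * x))).
  by rewrite ler_wpM2l//; lra.
have h : 0 <= (2 ^+ d - 1) * (x * (1 - x)) by rewrite !mulr_ge0//; lra.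
by move: h; set D := 2 ^+ d; nra.
Qed.

Lemma num_nodes_asymp d (s : d.-tuple EO) n : (1 <= d)%N -> (2 <= n)%N ->
  `| (num_nodes R n s)%:R / (2 * (n./2 ^ d)%:R) - 1 | <= (3 * (2 ^+ d - 1)) / n%:R :> R.
Proof.
move=> d1 n2; set q := n./2; have q1 : (1 <= q)%N by rewrite /q; lia.
have /andP[lo hi] := @num_nodes_bounds n d s (ltnW n2) d1.
have q0 : 0 < q%:R :> R by rewrite ltr0n.
have n0 : 0 < n%:R :> R by rewrite ltr0n; lia.
have p0 : 0 < 2 * (q ^ d)%:R :> R by rewrite mulr_gt0// ltr0n expn_gt0 q1.
have lo1 : 1 <= (num_nodes R n s)%:R / (2 * (q ^ d)%:R) :> R.
  by rewrite ler_pdivlMr// mul1r -natrM ler_nat.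
rewrite ger0_norm ?subr_ge0// lerBlDl.
apply: (@le_trans _ _ ((1 + q%:R^-1) ^+ d)).
  rewrite ler_pdivrMr// (_ : 1 + q%:R^-1 = q.+1%:R / q%:R).
    rewrite expr_div_n natrX mulrCA -mulrA mulVf ?expf_neq0 ?gt_eqF// mulr1.
    by rewrite -natrX -natrM ler_nat.
  by rewrite -natr1; field; rewrite gt_eqF.
have qi : 0 <= (q%:R^-1 : R) <= 1 by rewrite invr_ge0 ltW//= invf_le1 ?ler1n.
apply: (le_trans (exprD1_le d _ qi)); rewrite lerD2l mulrC mulrAC ler_wpM2r//.
  by rewrite subr_ge0 exprn_ege1//; lra.
(* 1 / q <= 3 / n, because n <= 2q + 1 <= 3q; this is the 3 in the constant. *)
rewrite ler_pdivlMr// ler_pdivrMl// -natrM ler_nat /q; lia.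
Qed.

End Nodes.

Theorem theorem1 (R : realType) (d : nat) (hd : (1 <= d)%N)
    (sigma : d.-tuple EO) :
  (forall (n : nat), (1 <= n)%N ->
     forall p : mpoly.mpoly d R, tdeg_le p (2 * n - 1) ->
       cube_integral (fun x => peval p x * cheb_weight x)
       = ((2 ^+ (d - 1) : R) * Isigma n sigma (peval p))%:E)
  /\
  (exists (C : R) (n0 : nat), forall n : nat, (n0 <= n)%N ->
     `| (num_nodes R n sigma)%:R / (2 * (n./2 ^ d)%:R) - 1 | <= C / n%:R).
Proof.
split; last first.
  (* From n = 2 on, [n./2] is positive and the ratio has a nonzero denominator. *)
  by exists (3 * (2 ^+ d - 1)), 2%N => n; exact: num_nodes_asymp.
move=> n n1 p dp.
have [J HJ] := choice (@integral_monomial R).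
pose c := fun m => mpoly.mcoeff m p.
pose e (m : mpoly.multinom d) (i : 'I_d) := mpoly.fun_of_multinom m i.
(* Each variable takes its own factor of the product weight, so a weighted monomial is again a
   product of one-variable functions. *)
pose u k (x : R) := x ^+ k * (pi^-1 * (Num.sqrt (1 - x ^+ 2))^-1).
have pE : peval p = fun x : d.-tuple R =>
    \sum_(m <- mpoly.msupp p) c m * \prod_(i < d) tnth x i ^+ e m i.
  by apply/funext => x; rewrite /peval mpoly.mevalE.
rewrite (_ : (fun x => _) = fun x : d.-tuple R =>
    \sum_(m <- mpoly.msupp p) c m * \prod_(i < d) u (e m i) (tnth x i)); last first.
  apply/funext => x; rewrite pE mulr_suml; apply: eq_bigr => m _.
  rewrite -mulrA; congr (_ * _); rewrite big_split/=; congr (_ * _).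
  by rewrite /cheb_weight big_split/= prodr_const card_ord exprVn.
rewrite (cube_integral_sum_prod u J); [|by move=> k; case: (HJ k)|by move=> k; case: (HJ k)].
rewrite /Isigma pE !(Iprod_sum_prod _ (fun k x => x ^+ k)); congr EFin.
rewrite -big_split/= mulr_sumr.
(* Keeps the membership of m in the support, which bounds its degree: mdeg m < msize p <= (2n - 1) +
   1 = 2n, as n >= 1. *)
apply: (@eq_big_seq _ _ _ (mpoly.mpoly_multinom__canonical__eqtype_Equality d)) => m mp.
rewrite -mulrDr mulrCA; congr (_ * _); apply: moment_prod => //.
- rewrite -mpoly.mdegE; have := mpoly.msize_mdeg_lt mp; move: dp; rewrite /tdeg_le; lia.
- by move=> k s0 kn; case: (HJ k) => _ _ + _; apply.
- by move=> k kn; case: (HJ k) => _ _ _; apply.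
Qed.
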